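(* Let $k,a,b$ be positive integers with $a\leqslant b$ coprime, let $\chi=(k-1)+a/b$, and let $\mu\in(0,1]$. There exists $\rho'_0>0$ such that for every $\rho'\in(0,\rho'_0]$ there is $\rho_0>0$ such that for every $\rho\in(0,\rho_0]$ there is $n_0$ such that for all $n\geqslant n_0$ and all $\ell,t\in\mathbb{N}$: if $G$ is a $\mu$-robust $(\chi,\rho;t,\ell)$-tiling framework on $n$ vertices, then $G$ contains a $B_\chi$-tiling covering at least $(1-\rho')n$ vertices.
   Context: Here $B_\chi$ denotes the complete $k$-partite graph with one part of size $a$ and $k-1$ parts of size $b$. A $B_\chi$-tiling in $G$ is a collection of vertex-disjoint copies of $B_\chi$ in $G$. A fractional $F$-tiling of $G$ is $\omega:\mathrm{Hom}(F;G)\to[0,1]$ with $\sum_\theta\omega(\theta)|\theta^{-1}(v)|\leqslant1$ for all $v$; weight $v(F)\sum_\theta\omega(\theta)$; $(1-\rho)$-perfect if weight $\geqslant(1-\rho)v(G)$. $K_k(G)$ is the $k$-graph of $k$-cliques of $G$. Tight components of a $k$-graph $J$: subhypergraphs whose edge sets are components of the graph on $E(J)$ with $e\sim f$ iff $|e\cap f|=k-1$. Loose components: unions of tight components forming components of the graph on tight components where two are adjacent iff their vertex sets meet. $J$ is $(t,\ell)$-connected if some vertex-spanning subgraph has at most $t$ tight and at most $\ell$ loose components. $v$ and edge $f\not\ni v$ are linked if some edge $e\ni v$ has $|e\cap f|=k-1$; $J$ is linked if every vertex is linked to an edge. $G$ is a $(\chi,\rho;t,\ell)$-tiling framework if it has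 a $(1-\rho)$-perfect fractional $B_\chi$-tiling and $K_{\lceil\chi\rceil}(G)$ is $(t,\ell)$-connected and linked. An $(\varepsilon,d)$-approximation of $G$ is a subgraph $G'$ with $\deg_{G'}(v)\geqslant\deg_G(v)-d\,v(G)$ for $v\in V(G')$ and $v(G')\geqslant(1-\varepsilon)v(G)$; $G$ is a $\mu$-robust $(\chi,\rho;t,\ell)$-tiling framework if every $(\mu,\mu)$-approximation of $G$ is a $(\chi,\rho;t,\ell)$-tiling framework. *)

(* Defs.v *)
From mathcomp Require Import all_boot all_order all_algebra.
From mathcomp Require Import reals.

Set Implicit Arguments.
Unset Strict Implicit.
Unset Printing Implicit Defensive.

Import Order.TTheory GRing.Theory Num.Theory.
Local Open Scope ring_scope.

(* All subgraphs of a given (hyper)graph share its ambient finite type [T];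
   the vertex set is an arbitrary subset of [T]. *)
Record kgraph (k : nat) (T : finType) := KGraph {
  verts : {set T};
  edges : {set {set T}};
  edgesP : forall e, e \in edges -> (#|e| == k) && (e \subset verts)
}.

Arguments KGraph {k T} verts edges edgesP.

Definition subgraph k (T : finType) (H G : kgraph k T) : Prop :=
  verts H \subset verts G /\ edges H \subset edges G.

(* Simple graphs are 2-uniform hypergraphs; no loops, as [set x; x] is not a
   2-element set. *)
Notation graph := (kgraph 2).

Definition adj (T : finType) (G : graph T) : rel T :=
  fun x y => [set x; y] \in edges G.

Definition deg (T : finType) (G : graph T) (v : T) : nat :=
  #|[set u | adj G v u]|.

Definition vertex k (T : finType) (G : kgraph k T) : finType :=
  {x : T | x \in verts G}.

Definition isomorphic (S T : finType) (F : graph S) (H : graph T) : Prop :=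
  exists f : vertex F -> vertex H,
    bijective f /\
    forall x y, adj H (val (f x)) (val (f y)) = adj F (val x) (val y).

Definition Hom (S T : finType) (F : graph S) (G : graph T) :
    {set {ffun vertex F -> vertex G}} :=
  [set theta : {ffun vertex F -> vertex G} |
    [forall x, forall y,
      adj F (val x) (val y) ==> adj G (val (theta x)) (val (theta y))]].

Definition copy (S T : finType) (F : graph S) (G H : graph T) : Prop :=
  subgraph H G /\ isomorphic F H.

Definition tiling (S T : finType) (F : graph S) (G : graph T)
    (m : nat) (H : 'I_m -> graph T) : Prop :=
  (forall i, copy F G (H i)) /\
  (forall i j, i != j -> [disjoint verts (H i) & verts (H j)]).

Definition fractional_tiling (R : realType) (S T : finType)
    (F : graph S) (G : graph T)
    (omega : {ffun vertex F -> vertex G} -> R) : Prop :=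
  (forall theta, theta \in Hom F G -> 0 <= omega theta <= 1) /\
  (forall v : vertex G,
    \sum_(theta in Hom F G)
      omega theta * #|[set x | theta x == v]|%:R <= 1).

Definition weight (R : realType) (S T : finType) (F : graph S) (G : graph T)
    (omega : {ffun vertex F -> vertex G} -> R) : R :=
  #|verts F|%:R * \sum_(theta in Hom F G) omega theta.

(* [rho] is the deficit: this is "(1 - rho)-perfect". *)
Definition almost_perfect (R : realType) (S T : finType)
    (F : graph S) (G : graph T) (rho : R)
    (omega : {ffun vertex F -> vertex G} -> R) : Prop :=
  (1 - rho) * #|verts G|%:R <= weight omega.

Section CompletePartite.
Variables (k : nat) (s : 'I_k -> nat).
Let V : finType := {i : 'I_k & 'I_(s i)}.

Definition partite_edges : {set {set V}} :=
  [set [set p.1; p.2] | p in [set p : V * V | tag p.1 != tag p.2]].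

Lemma partite_edgesP e :
  e \in partite_edges -> (#|e| == 2) && (e \subset [set: V]).
Proof.
case/imsetP=> -[x y]; rewrite inE /= => neq_tag ->.
have neq_xy : x != y by apply: contraNneq neq_tag => ->.
by rewrite subsetT andbT cards2 neq_xy.
Qed.

Definition complete_partite : graph V :=
  KGraph [set: V] partite_edges partite_edgesP.
End CompletePartite.

Definition part_size (k a b : nat) (i : 'I_k) : nat :=
  if val i == 0%N then a else b.

Definition Bchi (k a b : nat) := complete_partite (@part_size k a b).

Definition chi (R : realType) (k a b : nat) : R :=
  (k.-1)%:R + a%:R / b%:R.

Section Cliques.
Variables (r : nat) (T : finType) (G : graph T).

Definition clique_edges : {set {set T}} :=
  [set e : {set T} | [&& #|e| == r, e \subset verts G &
    [forall x in e, forall y in e, (x != y) ==> adj G x y]]].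

Lemma clique_edgesP e :
  e \in clique_edges -> (#|e| == r) && (e \subset verts G).
Proof. by rewrite inE => /and3P[-> ->]. Qed.

Definition cliques : kgraph r T :=
  KGraph (verts G) clique_edges clique_edgesP.
End Cliques.

Section Connectivity.
Variables (k : nat) (T : finType).
Implicit Type J : kgraph k T.

Definition tight_adj J : rel {set T} := fun e f =>
  [&& e \in edges J, f \in edges J & #|e :&: f| == k.-1].

(* A tight component is represented by its edge set [C]; its vertex set is
   [cover C]. *)
Definition tight_components J : {set {set {set T}}} :=
  equivalence_partition (connect (tight_adj J)) (edges J).

Definition loose_adj J : rel {set {set T}} := fun C D =>
  [&& C \in tight_components J, D \in tight_components J
    & cover C :&: cover D != set0].

(* A loose component is represented by the set of tight components of which
   it is the union. *)
Definition loose_components J : {set {set {set {set T}}}} :=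
  equivalence_partition (connect (loose_adj J)) (tight_components J).

(* Every vertex must lie in an edge of [J']: asking only for equal vertex sets
   would let the edgeless subgraph witness (0,0)-connectedness of any [J]. *)
Definition vertex_spanning J' J : Prop :=
  subgraph J' J /\ cover (edges J') = verts J.

Definition connected (t l : nat) J : Prop :=
  exists J', [/\ vertex_spanning J' J,
    (#|tight_components J'| <= t)%N & (#|loose_components J'| <= l)%N].

Definition linked_to J (v : T) (f : {set T}) : Prop :=
  v \notin f /\
  exists e, [/\ e \in edges J, v \in e & #|e :&: f| = k.-1].

Definition linked J : Prop :=
  forall v, v \in verts J -> exists f, f \in edges J /\ linked_to J v f.
End Connectivity.

Definition tiling_framework (R : realType) (T : finType)
    (k a b : nat) (rho : R) (t l : nat) (G : graph T) : Prop :=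
  (exists omega : {ffun vertex (Bchi k a b) -> vertex G} -> R,
     fractional_tiling omega /\ almost_perfect rho omega) /\
  let J := cliques `|Num.ceil (chi R k a b)|%N G in
  connected t l J /\ linked J.

Definition approximation (R : realType) (T : finType) (eps d : R)
    (G' G : graph T) : Prop :=
  [/\ subgraph G' G,
      forall v, v \in verts G' ->
        (deg G v)%:R - d * #|verts G|%:R <= (deg G' v)%:R
    & (1 - eps) * #|verts G|%:R <= #|verts G'|%:R :> R].

Definition robust_tiling_framework (R : realType) (T : finType) (mu : R)
    (k a b : nat) (rho : R) (t l : nat) (G : graph T) : Prop :=
  forall G' : graph T, approximation mu mu G' G ->
    tiling_framework k a b rho t l G'.

(* Main.v *)
(* Colour the vertices so that, apart from few edges, every pair of colour
   classes carrying an edge is lower-dense: large subsets span a positive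
   proportion of edges.  Such a colouring comes from decreasing the squared
   distance between the adjacency function and a step function.  Deleting the
   remaining edges, the vertices meeting many of them and the small classes
   leaves an approximation G' of G, which therefore has an almost perfect
   fractional B-tiling.  Grouping homomorphisms B -> G' by the colours of the
   images of the vertices of B and rounding down the weight of each group says
   how many copies of B of each colour pattern to take.  They can be chosen
   greedily: a small proportion of every class stays unused, and lower density
   lets one embed a copy of B with the given pattern into unused vertices.
   The argument works for an arbitrary graph B. *)
Require Import Defs.
From mathcomp Require Import all_boot all_order all_algebra.
From mathcomp Require Import reals.
From mathcomp Require Import ring lra.

Set Implicit Arguments.
Unset Strict Implicit.
Unset Printing Implicit Defensive.

Import Order.TTheory GRing.Theory Num.Theory.
Local Open Scope ring_scope.

(** * Lower-dense regularity *)

Definition edge_count (R : realType) (T : finType) (e : rel T)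
    (A B : {set T}) : R :=
  \sum_(x in A) \sum_(y in B) (e x y)%:R.

(** Only the lower half of regularity is demanded: the embedding needs many neighbours and never an
    upper bound on their number. *)
Definition lower_dense (R : realType) (T : finType) (e : rel T)
    (eps delta : R) (A B : {set T}) : bool :=
  [forall X : {set T}, forall Y : {set T},
    [&& X \subset A, Y \subset B, eps * #|A|%:R <= #|X|%:R
      & eps * #|B|%:R <= #|Y|%:R] ==>
    (delta * (#|X|%:R * #|Y|%:R) <= edge_count R e X Y)].

Definition color_class (T I : finType) (W : {set T}) (c : T -> I) (i : I) :
    {set T} :=
  [set x in W | c x == i].

(** Edges, not pairs, are counted: a sparse block that fails to be lower-dense does little harm,
    because its few edges can be deleted. *)
Definition defect_count (R : realType) (T I : finType) (e : rel T)
    (W : {set T}) (c : T -> I) (eps delta : R) : R :=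
  \sum_(x in W) \sum_(y in W)
    (e x y && ~~ lower_dense e eps delta (color_class W c (c x))
                                         (color_class W c (c y)))%:R.

(** The values [g] are arbitrary rather than block densities, so a refinement may shift them
    directly and no averaging inequality is involved. *)
Definition step_error (R : realType) (T I : finType) (e : rel T)
    (W : {set T}) (c : T -> I) (g : I -> I -> R) : R :=
  \sum_(x in W) \sum_(y in W) ((e x y)%:R - g (c x) (c y)) ^+ 2.

Section Regularity.
Variables (R : realType) (T : finType) (e : rel T) (W : {set T}).
Variables (eps delta : R).
Hypotheses (eps_gt0 : 0 < eps) (eps_le1 : eps <= 1) (delta_gt0 : 0 < delta).

Local Notation dense := (lower_dense e eps delta).

Lemma edge_countC (A B : {set T}) : symmetric e ->
  edge_count R e A B = edge_count R e B A.
Proof.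
move=> e_sym; rewrite /edge_count exchange_big /=.
by apply: eq_bigr => x _; apply: eq_bigr => y _; rewrite e_sym.
Qed.

Lemma lower_denseC (A B : {set T}) : symmetric e -> dense A B -> dense B A.
Proof.
move=> e_sym /forallP AB; apply/forallP => X; apply/forallP => Y.
apply/implyP => /and4P[XB YA cX cY].
have /forallP/(_ X)/implyP := AB Y.
rewrite (edge_countC _ _ e_sym) [_ * #|X|%:R]mulrC; apply.
by rewrite YA XB cY cX.
Qed.

Lemma lower_denseP (A B X Y : {set T}) : dense A B ->
  X \subset A -> Y \subset B -> eps * #|A|%:R <= #|X|%:R ->
  eps * #|B|%:R <= #|Y|%:R ->
  delta * (#|X|%:R * #|Y|%:R) <= edge_count R e X Y.
Proof.
by move=> /forallP/(_ X)/forallP/(_ Y)/implyP AB *; apply: AB; apply/and4P.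
Qed.

Lemma sum_color_classes (I : finType) (c : T -> I) (F : T -> R) :
  \sum_(x in W) F x = \sum_i \sum_(x in color_class W c i) F x.
Proof.
rewrite (partition_big c predT) //=; apply: eq_bigr => i _.
by apply: eq_bigl => x; rewrite inE.
Qed.

Lemma sum_color_class_pairs (I : finType) (c : T -> I) (F : T -> T -> R) :
  \sum_(x in W) \sum_(y in W) F x y =
  \sum_i \sum_j \sum_(x in color_class W c i) \sum_(y in color_class W c j) F x y.
Proof.
rewrite (sum_color_classes c); apply: eq_bigr => i _.
under eq_bigr do rewrite (sum_color_classes c).
by rewrite exchange_big.
Qed.

Lemma sum_const_pairs (A B : {set T}) (z : R) :
  \sum_(x in A) \sum_(y in B) z = z * (#|A|%:R * #|B|%:R).
Proof.
under eq_bigr do rewrite sumr_const.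
by rewrite sumr_const -natrM mulr_natr mulnC mulrnA.
Qed.

Lemma sum_shift_pairs (A B : {set T}) (z s : R) :
  \sum_(x in A) \sum_(y in B) (s ^+ 2 - 2 * s * ((e x y)%:R - z)) =
  (s ^+ 2 + 2 * s * z) * (#|A|%:R * #|B|%:R) - 2 * s * edge_count R e A B.
Proof.
rewrite -sum_const_pairs /edge_count mulr_sumr -sumrB; apply: eq_bigr => x _.
rewrite mulr_sumr -sumrB; apply: eq_bigr => y _; ring.
Qed.

(* Shifting the step function by [s] on [X * Y] changes its squared error by
   the sum on the right.  In a block that is neither lower-dense nor sparse,
   either the current value [z] is below [2 * delta] and can be raised on the
   whole block, or it can be lowered on the rectangle witnessing the defect. *)
Lemma exists_block_shift (A B : {set T}) (z : R) :
  exists XYs : {set T} * {set T} * R,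
    [/\ XYs.1.1 \subset A, XYs.1.2 \subset B &
    delta ^+ 2 * eps ^+ 2 *
      (\sum_(x in A) \sum_(y in B) (e x y && ~~ dense A B)%:R
       - 3 * delta * (#|A|%:R * #|B|%:R)) <=
    - \sum_(x in XYs.1.1) \sum_(y in XYs.1.2)
        (XYs.2 ^+ 2 - 2 * XYs.2 * ((e x y)%:R - z))].
Proof.
have de_gt0 : 0 < delta ^+ 2 * eps ^+ 2 by rewrite mulr_gt0 ?exprn_gt0.
have AB_ge0 : 0 <= (#|A|%:R * #|B|%:R : R) by rewrite mulr_ge0.
have [AB|nAB] := boolP (dense A B).
  exists (set0, set0, 0); rewrite !sub0set /= big_set0 oppr0; split=> //.
  under eq_bigr do under eq_bigr do rewrite andbF.
  rewrite sum_const_pairs mul0r sub0r pmulr_rle0 // oppr_le0.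
  by rewrite mulr_ge0 // mulr_ge0 // ltW.
under eq_bigr do under eq_bigr do rewrite andbT.
rewrite -/(edge_count R e A B).
have [sparse|thick] := ltP (edge_count R e A B) (3 * delta * (#|A|%:R * #|B|%:R)).
  exists (set0, set0, 0); rewrite !sub0set /= big_set0 oppr0; split=> //.
  by rewrite pmulr_rle0 // subr_le0 ltW.
have EAB : edge_count R e A B <= #|A|%:R * #|B|%:R.
  rewrite -[leRHS]mul1r -sum_const_pairs; apply: ler_sum => x _.
  by apply: ler_sum => y _; case: (e x y).
have bound : delta ^+ 2 * eps ^+ 2 * (edge_count R e A B
    - 3 * delta * (#|A|%:R * #|B|%:R)) <=
    delta ^+ 2 * (eps * #|A|%:R * (eps * #|B|%:R)).
  rewrite [leRHS](_ : _ = delta ^+ 2 * eps ^+ 2 * (#|A|%:R * #|B|%:R)); last ring.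
  rewrite ler_pM2l //; apply: le_trans EAB.
  by rewrite lerBlDr lerDl mulr_ge0 // mulr_ge0 // ltW.
(* In both cases the density of the chosen rectangle differs from [z] by at least [delta]: at least
   [3 * delta] against less than [2 * delta], or less than [delta] against at least [2 * delta]. A
   shift by [delta] towards it gains [delta ^+ 2] per pair. *)
have [z_small|z_big] := ltP z (2 * delta).
  exists (A, B, delta); rewrite !subxx; split=> //=.
  apply: le_trans bound _; rewrite sum_shift_pairs.
  have -> : delta ^+ 2 * (eps * #|A|%:R * (eps * #|B|%:R)) =
            eps ^+ 2 * (delta ^+ 2 * (#|A|%:R * #|B|%:R)) by ring.
  have d2AB : 0 <= delta ^+ 2 * (#|A|%:R * #|B|%:R : R).
    by rewrite mulr_ge0 // exprn_ge0 // ltW.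
  have e2 : eps ^+ 2 <= 1 by rewrite expr_le1 // ltW.
  have h1 := ler_wpM2r d2AB e2.
  have h2 : delta * z * (#|A|%:R * #|B|%:R) <=
            delta * (2 * delta) * (#|A|%:R * #|B|%:R).
    by rewrite ler_wpM2r // ler_wpM2l // ltW.
  have h3 : delta * (3 * delta * (#|A|%:R * #|B|%:R)) <=
            delta * edge_count R e A B by rewrite ler_wpM2l // ltW.
  nra.
move: nAB => /forallPn[X /forallPn[Y]]; rewrite negb_imply -ltNge.
case/andP=> /and4P[XA YB cX cY] sparse.
exists (X, Y, - delta); split=> //=; apply: le_trans bound _.
rewrite sum_shift_pairs.
have XY : eps * #|A|%:R * (eps * #|B|%:R) <= #|X|%:R * #|Y|%:R :> R.
  by rewrite ler_pM // mulr_ge0 // ltW.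
have h1 := ler_wpM2l (exprn_ge0 2 (ltW delta_gt0)) XY.
have h2 : delta * edge_count R e X Y <= delta * (delta * (#|X|%:R * #|Y|%:R)).
  by rewrite ler_wpM2l // ltW.
have h3 : delta * (2 * delta) * (#|X|%:R * #|Y|%:R) <=
          delta * z * (#|X|%:R * #|Y|%:R).
  by rewrite ler_wpM2r ?mulr_ge0 // ler_wpM2l // ltW.
nra.
Qed.

(** Shifts in different blocks do not interfere, so the gains of [exists_block_shift] add up over
    all blocks. *)
Lemma step_error_decrement (I : finType) (c : T -> I) (g : I -> I -> R) :
  exists (I' : finType) (c' : T -> I') (g' : I' -> I' -> R),
    #|I'| = (#|I| * 4 ^ #|I|)%N /\
    step_error e W c' g' <= step_error e W c g -
      delta ^+ 2 * eps ^+ 2 *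
        (defect_count e W c eps delta - 3 * delta * #|W|%:R ^+ 2).
Proof.
pose V := color_class W c.
have [f fP] := fin_all_exists (fun ij : I * I =>
  exists_block_shift (V ij.1) (V ij.2) (g ij.1 ij.2)).
pose X i j := (f (i, j)).1.1; pose Y i j := (f (i, j)).1.2.
pose s i j := (f (i, j)).2.
(* The new colour of [x] records its old colour and, for each colour [j], whether [x] lies in the
   left rectangle side for the block with [j] and in the right side for the block from [j]. This
   makes every shifted function a step function of the new colours. *)
pose I' : finType := (I * {ffun I -> bool * bool})%type.
pose c' x : I' :=
  (c x, [ffun j => (x \in X (c x) j, x \in Y j (c x))]).
pose g' (u v : I') :=
  g u.1 v.1 + s u.1 v.1 * ((u.2 v.1).1 && (v.2 u.1).2)%:R.
exists I', c', g'; split.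
  by rewrite card_prod card_ffun card_prod card_bool.
have -> : 3 * delta * #|W|%:R ^+ 2 =
    \sum_i \sum_j 3 * delta * (#|V i|%:R * #|V j|%:R).
  rewrite expr2 -sum_const_pairs (sum_color_class_pairs c).
  by apply: eq_bigr => i _; apply: eq_bigr => j _; rewrite sum_const_pairs.
rewrite /defect_count (sum_color_class_pairs c) lerBrDr -lerBrDl.
rewrite -sumrB mulr_sumr /step_error -sumrB.
under [leRHS]eq_bigr do rewrite -sumrB.
rewrite (sum_color_class_pairs c).
apply: ler_sum => i _; rewrite -sumrB mulr_sumr; apply: ler_sum => j _.
have [/= XA YB shift] := fP (i, j).
rewrite -/(X i j) -/(Y i j) -/(s i j) in XA YB shift.
have -> : \sum_(x in V i) \sum_(y in V j)
      (e x y && ~~ dense (color_class W c (c x)) (color_class W c (c y)))%:R =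
    \sum_(x in V i) \sum_(y in V j) (e x y && ~~ dense (V i) (V j))%:R :> R.
  apply: eq_bigr => x; rewrite inE => /andP[_ /eqP ->].
  by apply: eq_bigr => y; rewrite inE => /andP[_ /eqP ->].
apply: le_trans shift _; rewrite le_eqVlt; apply/orP; left; apply/eqP.
(* Extending the sum by zero from the rectangle to the whole block allows a comparison term by
   term. *)
transitivity (- \sum_(x in V i) \sum_(y in V j)
    ((x \in X i j) && (y \in Y i j))%:R *
    (s i j ^+ 2 - 2 * s i j * ((e x y)%:R - g i j))).
  congr (- _); rewrite [RHS](big_setID (X i j)) /= (setIidPr XA).
  rewrite [X in _ = _ + X]big1 ?addr0; last first.
    move=> x /setDP[_ /negPf ->]; rewrite big1 // => y _; exact: mul0r.
  apply: eq_bigr => x xX; rewrite [RHS](big_setID (Y i j)) /= (setIidPr YB).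
  rewrite [X in _ = _ + X]big1 ?addr0; last first.
    by move=> y /setDP[_ /negPf ->]; rewrite andbF mul0r.
  by apply: eq_bigr => y yY; rewrite xX yY mul1r.
rewrite -sumrN; apply: eq_bigr => x; rewrite inE => /andP[_ /eqP cx].
rewrite -sumrN; apply: eq_bigr => y; rewrite inE => /andP[_ /eqP cy].
rewrite /g' /c' /= !ffunE /= cx cy.
by case: (_ && _); rewrite /=; ring.
Qed.

End Regularity.

(** Tower-type bound on the colours after [r] refinements of the trivial colouring. *)
Fixpoint color_bound (r : nat) : nat :=
  if r is r'.+1 then (color_bound r' * 4 ^ color_bound r')%N else 1%N.

Lemma color_bound_gt0 r : (0 < color_bound r)%N.
Proof. by elim: r => //= r IH; rewrite muln_gt0 IH expn_gt0. Qed.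

Lemma color_bound_homo r q : (r <= q)%N -> (color_bound r <= color_bound q)%N.
Proof.
elim: q => [|q IH]; first by rewrite leqn0 => /eqP ->.
rewrite leq_eqVlt => /predU1P[-> //|/IH /leq_trans]; apply.
by rewrite /= leq_pmulr // expn_gt0.
Qed.

Lemma color_bound_step m r :
  (m <= color_bound r)%N -> (m * 4 ^ m <= color_bound r.+1)%N.
Proof. by move=> le_m; rewrite /= leq_mul // leq_exp2l. Qed.

(* A version of Szemeredi's regularity lemma in which blocks need only be
   regular from below and may be unbalanced. *)
Lemma regularity (R : realType) (eps delta : R) :
  0 < eps -> eps <= 1 -> 0 < delta ->
  exists M : nat, (0 < M)%N /\
  forall (T : finType) (e : rel T) (W : {set T}),
  exists (I : finType) (c : T -> I), (#|I| <= M)%N /\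
    defect_count e W c eps delta <= 4 * delta * #|W|%:R ^+ 2.
Proof.
move=> eps_gt0 eps_le1 delta_gt0.
pose kappa := delta ^+ 2 * eps ^+ 2 * delta.
have kappa_gt0 : 0 < kappa by rewrite !mulr_gt0 ?exprn_gt0.
(* The error is at most [w] at the start and each unsuccessful round removes [kappa * w], so [N]
   such rounds would make it negative. *)
pose N := (Num.truncn kappa^-1).+1.
have N_gt : 1 < N%:R * kappa.
  by rewrite -ltr_pdivrMr // div1r truncnS_gt // invr_ge0 ltW.
exists (color_bound N); split; first exact: color_bound_gt0.
move=> T e W; set w : R := #|W|%:R ^+ 2.
have w_ge0 : 0 <= w by rewrite exprn_ge0.
have [w0|w_neq0] := eqVneq w 0.
  exists unit, (fun=> tt); split; first by rewrite card_unit color_bound_gt0.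
  rewrite w0 mulr0; have /eqP : #|W|%:R = 0 :> R.
    by apply/eqP; rewrite -sqrf_eq0 -/w w0.
  rewrite pnatr_eq0 cards_eq0 => /eqP ->.
  by rewrite /defect_count big_set0.
have w_gt0 : 0 < w by rewrite lt_neqAle eq_sym w_neq0.
suff iterate r : (exists (I : finType) (c : T -> I), (#|I| <= color_bound r)%N /\
      defect_count e W c eps delta <= 4 * delta * w) \/
    (exists (I : finType) (c : T -> I) (g : I -> I -> R),
      (#|I| <= color_bound r)%N /\ step_error e W c g <= (1 - r%:R * kappa) * w).
  have [//|[I [c [g [_ err]]]]] := iterate N.
  have err_ge0 : 0 <= step_error e W c g.
    by apply: sumr_ge0 => x _; apply: sumr_ge0 => y _; rewrite sqr_ge0.
  have := le_trans err_ge0 err; rewrite pmulr_lge0 // subr_ge0.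
  by rewrite leNgt N_gt.
elim: r => [|r [[I [c [cI good]]]|[I [c [g [cI err]]]]]].
- right; exists unit, (fun=> tt), (fun _ _ => 0); rewrite card_unit; split=> //.
  rewrite mul0r subr0 /w expr2 -sum_const_pairs.
  apply: ler_sum => x _; apply: ler_sum => y _; rewrite subr0.
  by case: (e x y); rewrite ?expr0n ?expr1n.
- by left; exists I, c; split=> //; apply: leq_trans cI (color_bound_homo _).
have [good|bad] := leP (defect_count e W c eps delta) (4 * delta * w).
  by left; exists I, c; split=> //; apply: leq_trans cI (color_bound_homo _).
right; have [I' [c' [g' [cI' err']]]] :=
  step_error_decrement e W eps_gt0 eps_le1 delta_gt0 c g.
exists I', c', g'; split; first by rewrite cI' color_bound_step.
apply: le_trans err' _; rewrite -/w.
(* A bad colouring has defect above [4 * delta * w], which leaves an excess of [delta * w] over the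
   [3 * delta * w] allowed in the decrement; this is the last factor of [kappa]. *)
have : kappa * w <= delta ^+ 2 * eps ^+ 2 *
    (defect_count e W c eps delta - 3 * delta * w).
  rewrite /kappa -mulrA ler_pM2l ?mulr_gt0 ?exprn_gt0 //; lra.
rewrite -natr1; nra.
Qed.

(** * Embedding into lower-dense blocks *)

Section Embedding.
Variables (R : realType) (T : finType) (e : rel T) (eps delta : R).
Hypotheses (eps_gt0 : 0 < eps) (delta_gt0 : 0 < delta) (delta_le1 : delta <= 1).

(** Otherwise the low-degree set is large enough for lower density to apply, yet it sends too few
    edges to [Y]. Positivity of [eps * #|A|%:R] makes that set nonempty, so the sum inequality is
    strict. *)
Lemma few_low_degree_vertices (A B C Y : {set T}) :
  lower_dense e eps delta A B -> C \subset A -> Y \subset B ->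
  eps * #|B|%:R <= #|Y|%:R -> 0 < eps * #|A|%:R ->
  #|[set v in C | \sum_(y in Y) (e v y)%:R < delta * #|Y|%:R]|%:R
    < eps * #|A|%:R.
Proof.
move=> AB CA YB cY A_gt0; set X := [set v in C | _].
rewrite ltNge; apply/negP => cX.
have XA : X \subset A by apply: subset_trans CA; apply/subsetP => v /setIdP[].
have := lower_denseP AB XA YB cX cY; apply/negP; rewrite -ltNge.
rewrite mulrCA mulr_natl -sumr_const.
have /card_gt0P[v0 v0X] : (0 < #|X|)%N.
  by rewrite -(ltr0n R); apply: lt_le_trans cX.
apply: ltr_sum; last by move=> v /setIdP[].
by apply/hasP; exists v0; rewrite ?mem_index_enum.
Qed.

Variables (U : finType) (f : rel U) (P : U -> {set T}).
Hypotheses (e_sym : symmetric e) (f_sym : symmetric f).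
Hypothesis f_dense : forall x y, f x y -> lower_dense e eps delta (P x) (P y).
Hypothesis P_large : forall x, 2 / delta <= eps * #|P x|%:R.

(* Vertices are embedded one at a time; an unembedded vertex loses at most a
   factor [delta / 2] of its candidates at each step. *)
Lemma embed_seq (s : seq U) (C : U -> {set T}) : uniq s ->
  (forall x, x \in s -> C x \subset P x) ->
  (forall x, x \in s ->
     (2 / delta) ^+ size s * (#|U|.+1%:R * (eps * #|P x|%:R)) <= #|C x|%:R) ->
  exists phi : U -> T, [/\ forall x, x \in s -> phi x \in C x,
    {in s &, injective phi} &
    {in s &, forall x y, f x y -> x != y -> e (phi x) (phi y)}].
Proof.
have two_delta : 1 <= 2 / delta.
  by rewrite ler_pdivlMr // mul1r (le_trans delta_le1) // ler1n.
have eP_gt0 x : 0 < eps * #|P x|%:R.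
  by apply: lt_le_trans (P_large x); rewrite divr_gt0.
have h_gt0 : 0 < #|U|.+1%:R :> R by rewrite ltr0n.
elim: s C => [|x s IH] C.
  (* [phi] is total on [U], so it needs values off the list as well; [P_large] makes each [P x]
     nonempty. *)
  move=> _ _ _; suff [phi _] : exists phi, forall x, phi x \in P x by exists phi.
  apply: (fin_all_exists (P := fun x t => t \in P x)) => x; apply/card_gt0P.
  by have := eP_gt0 x; rewrite pmulr_rgt0 // ltr0n.
move=> /= /andP[xs s_uniq] CP cC.
have large y : y \in x :: s -> #|U|.+1%:R * (eps * #|P y|%:R) <= #|C y|%:R.
  move=> /cC; apply: le_trans; rewrite ler_peMl //; first by rewrite mulr_ge0 // ltW.
  exact: exprn_ege1.
have large1 y : y \in x :: s -> eps * #|P y|%:R <= #|C y|%:R.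
  by move/large; apply: le_trans; rewrite ler_peMl ?ler1n // ltW.
pose low y := [set v in C x | \sum_(z in C y) (e v z)%:R < delta * #|C y|%:R].
(* At most [#|U|] low sets, each smaller than [eps * #|P x|%:R], cannot cover [C x], which has at
   least [#|U|.+1] times that size. *)
have [v vC v_high] : exists2 v, v \in C x &
    forall y, y \in s -> f x y -> delta * #|C y|%:R <= \sum_(z in C y) (e v z)%:R.
  pose low_union := \bigcup_(y in [set y in s | f x y]) low y.
  have [v /setDP[vC vlow]|none] := pickP (mem (C x :\: low_union)).
    exists v => // y ys xy; rewrite leNgt; apply: contra vlow => v_low.
    by apply/bigcupP; exists y; rewrite inE ?ys ?vC.
  have /subset_leq_card : C x \subset low_union.
    by rewrite -setD_eq0; apply/eqP/setP => v; rewrite in_set0; apply: none.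
  rewrite -(ler_nat R) => c_low; exfalso.
  have := le_trans (large x (mem_head _ _)) c_low; apply/negP; rewrite -ltNge.
  apply: (@le_lt_trans _ _ (\sum_(y in [set y in s | f x y]) eps * #|P x|%:R)).
    apply: (@le_trans _ _ (\sum_(y in [set y in s | f x y]) #|low y|%:R)).
      rewrite -natr_sum ler_nat /low_union.
      apply: (big_ind2 (fun (A : {set T}) n => #|A| <= n)%N).
      - by rewrite cards0.
      - move=> A1 n1 A2 n2 l1 l2; apply: leq_trans (leq_card_setU A1 A2) _.
        exact: leq_add.
      - by [].
    apply: ler_sum => y /setIdP[ys xy].
    have y_xs : y \in x :: s by rewrite inE ys orbT.
    exact/ltW/(few_low_degree_vertices (f_dense xy) (CP x (mem_head _ _))
                 (CP y y_xs) (large1 y y_xs) (eP_gt0 x)).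
  rewrite sumr_const -[_ *+ _]mulr_natl ltr_pM2r // ltr_nat ltnS.
  exact: max_card.
pose C' y := [set z in C y | f x y ==> e v z] :\ v.
have C'C y : C' y \subset C y.
  by apply/subsetP => z /setD1P[_ /setIdP[]].
have cC' y : y \in s -> delta / 2 * #|C y|%:R <= #|C' y|%:R.
  move=> ys; have y_xs : y \in x :: s by rewrite inE ys orbT.
  have nbrs : delta * #|C y|%:R <= #|[set z in C y | f x y ==> e v z]|%:R.
    have [xy|nxy] := boolP (f x y).
      apply: le_trans (v_high y ys xy) _; rewrite -natr_sum ler_nat.
      rewrite -sum1dep_card big_mkcondr.
      by apply: leq_sum => z _; case: (e v z).
    have -> : [set z in C y | false ==> e v z] = C y.
      by apply/setP => z; rewrite inE andbT.
    by rewrite ler_piMl.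
  have removed : #|[set z in C y | f x y ==> e v z]|%:R <= #|C' y|%:R + 1 :> R.
    by rewrite natr1 ler_nat (cardsD1 v) -addn1 addnC leq_add2l leq_b1.
  (* Removing [v] for injectivity costs one candidate. Since [delta * #|C y|%:R] is at least 2, half
     of it still remains. *)
  have := le_trans (P_large y) (large1 y y_xs); rewrite ler_pdivrMr // => Cy2.
  lra.
have [||phi [phiC phi_inj phi_e]] := IH C' s_uniq.
- by move=> y ys; apply: subset_trans (C'C y) (CP y _); rewrite inE ys orbT.
- move=> y ys; apply: le_trans _ (cC' y ys).
  have := cC y; rewrite inE ys orbT => /(_ isT); rewrite exprS -mulrA => cCy.
  have d2_ge0 : 0 <= delta / 2 by rewrite divr_ge0 // ltW.
  apply: le_trans (ler_wpM2l d2_ge0 cCy).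
  by rewrite [leRHS]mulrA [delta / 2 * _](_ : _ = 1) ?mul1r //; field; rewrite gt_eqF.
have phi_x y : y \in s -> phi y \in C y /\ phi y != v.
  by move/phiC => /setD1P[? /setIdP[]].
exists (fun z => if z == x then v else phi z); split.
- move=> y; rewrite inE; have [-> _|_ /= ys] := eqVneq y x; first exact: vC.
  by have [] := phi_x y ys.
- move=> y z; rewrite !inE.
  have [->|_] := eqVneq y x; have [->|_] //= := eqVneq z x.
  + by move=> _ /phi_x[_ /eqP nv] v_eq; case: nv.
  + by move=> /phi_x[_ /eqP nv] _ v_eq; case: nv.
  + exact: phi_inj.
- move=> y z; rewrite !inE.
  have [->|_] := eqVneq y x; have [->|_] //= := eqVneq z x.
  + by move=> _ /phiC /setD1P[_ /setIdP[_ /implyP nb]] /nb.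
  + move=> /phiC /setD1P[_ /setIdP[_ /implyP nb]] _ yx _.
    by rewrite e_sym nb // f_sym.
  + exact: phi_e.
Qed.

(** [Z] stands for the vertices taken by earlier copies. The bound on [gamma] ensures that the
    candidates left outside [Z] survive all [#|U|] shrinkings. *)
Lemma embed_avoiding (gamma : R) (Z : {set T}) : irreflexive f ->
  (2 / delta) ^+ #|U| * (#|U|.+1%:R * eps) <= gamma ->
  (forall x, gamma * #|P x|%:R <= #|P x :\: Z|%:R) ->
  exists phi : {ffun U -> T}, [/\ injective phi,
    forall x, phi x \in P x :\: Z & forall x y, f x y -> e (phi x) (phi y)].
Proof.
move=> f_irr gamma_large Z_small.
have [||phi [phiP phi_inj phi_e]] :=
  @embed_seq (enum U) (fun x => P x :\: Z) (enum_uniq U).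
- by move=> x _; apply: subsetDl.
- move=> x _; apply: le_trans _ (Z_small x); rewrite -cardE !mulrA.
  by rewrite ler_wpM2r // -mulrA.
exists [ffun x => phi x]; split.
- by move=> x y; rewrite !ffunE; apply: phi_inj; rewrite mem_enum.
- by move=> x; rewrite ffunE; apply: phiP; rewrite mem_enum.
- move=> x y xy; rewrite !ffunE; apply: phi_e; rewrite ?mem_enum //.
  by apply: contraTneq xy => ->; rewrite f_irr.
Qed.

End Embedding.

(** * Greedy tilings *)

Section Greedy.
Variables (R : realType) (T I U : finType) (e : rel T) (f : rel U).
Variables (W : {set T}) (c : T -> I) (gamma : R).

Local Notation V := (color_class W c).

Definition image_set (phi : {ffun U -> T}) : {set T} := [set phi x | x : U].

Definition used (L : seq {ffun U -> T}) : {set T} :=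
  \bigcup_(phi <- L) image_set phi.

Definition disjoint_embeddings (L : seq {ffun U -> T}) : Prop :=
  [/\ forall phi, phi \in L ->
        [/\ injective phi, image_set phi \subset W &
            forall x y, f x y -> e (phi x) (phi y)],
      pairwise (fun phi psi => [disjoint image_set phi & image_set psi]) L &
      #|used L| = (#|U| * size L)%N].

(** A class loses no more vertices than its multiplicity in the patterns already realised. The
    capacity bound therefore keeps a [gamma] fraction of each class required by the next pattern
    free, and the next copy is placed outside [used L]. *)
Lemma greedy_embeddings (s : seq {ffun U -> I}) :
  (forall tau, tau \in s -> forall Z : {set T},
    (forall x, gamma * #|V (tau x)|%:R <= #|V (tau x) :\: Z|%:R) ->
    exists phi : {ffun U -> T}, [/\ injective phi,
      forall x, phi x \in V (tau x) :\: Z &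
      forall x y, f x y -> e (phi x) (phi y)]) ->
  (forall i, (\sum_(tau <- s) #|[set x | tau x == i]|)%:R
     <= (1 - gamma) * #|V i|%:R) ->
  exists L, [/\ disjoint_embeddings L, size L = size s &
    forall i, (#|V i :&: used L| <= \sum_(tau <- s) #|[set x | tau x == i]|)%N].
Proof.
elim: s => [|tau s IH] emb cap.
  exists [::]; split=> //; last by move=> i; rewrite /used big_nil setI0 cards0.
  by split=> //; rewrite /used big_nil cards0 muln0.
have [|i|L [[L_emb L_disj L_card] L_size L_used]] := IH.
- by move=> tau' ss; apply: emb; rewrite inE ss orbT.
- by apply: le_trans (cap i); rewrite big_cons ler_nat leq_addl.
have [|phi [phi_inj phiV phi_e]] := emb tau (mem_head _ _) (used L).
  move=> x; have := cardsID (used L) (V (tau x)) => /(congr1 (fun m => m%:R : R)).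
  have := cap (tau x); rewrite big_cons natrD natrD.
  have : #|V (tau x) :&: used L|%:R <=
      (\sum_(tau0 <- s) #|[set x0 | tau0 x0 == tau x]|)%:R :> R.
    by rewrite ler_nat.
  have : 0 <= #|[set x0 | tau x0 == tau x]|%:R :> R by [].
  lra.
have new : [disjoint image_set phi & used L].
  rewrite disjoint_subset; apply/subsetP => _ /imsetP[x _ ->].
  by have /setDP[] := phiV x; rewrite inE.
exists (phi :: L); rewrite /= L_size; split=> //.
- split.
  + move=> psi; rewrite inE => /predU1P[-> |/L_emb //]; split=> //.
    apply/subsetP => _ /imsetP[x _ ->].
    by have /setDP[/setIdP[]] := phiV x.
  + rewrite /= L_disj andbT; apply/allP => psi psiL.
    by apply: disjointWr new; rewrite /used (big_rem psi psiL) subsetUl.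
  + rewrite /used big_cons -/(used L) cardsU disjoint_setI0 // cards0 subn0.
    by rewrite card_imset // L_card mulnS.
- move=> i; rewrite /used !big_cons -/(used L) setIUr.
  apply: leq_trans (leq_card_setU _ _) _; apply: leq_add (L_used i).
  rewrite -(card_imset _ phi_inj); apply/subset_leq_card/subsetP => t.
  case/setIP=> /setIdP[_ /eqP ct] /imsetP[x _ tE]; rewrite tE imset_f // inE.
  by have /setDP[/setIdP[_ /eqP <-]] := phiV x; rewrite -tE ct.
Qed.

End Greedy.

(** * Copies of a graph from embeddings *)

Lemma adjC (T : finType) (G : graph T) : symmetric (adj G).
Proof. by move=> x y; rewrite /adj setUC. Qed.

Lemma adj_irr (T : finType) (G : graph T) : irreflexive (adj G).
Proof.
move=> x; apply/negP => /edgesP /andP[].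
by rewrite setUid cards1.
Qed.

Lemma adj_verts (T : finType) (G : graph T) (x y : T) :
  adj G x y -> (x \in verts G) && (y \in verts G).
Proof. by move=> /edgesP /andP[_]; rewrite subUset !sub1set. Qed.

Definition adj_on (S : finType) (F : graph S) : rel (vertex F) :=
  fun x y => adj F (val x) (val y).
Arguments adj_on {S} F.

Lemma card_vertex k (T : finType) (G : kgraph k T) : #|vertex G| = #|verts G|.
Proof. by rewrite card_sig; apply: eq_card => x; rewrite inE. Qed.

Section ImageGraph.
Variables (S T : finType) (F : graph S) (G : graph T).

(** Only images of edges of [F] are kept, not all edges induced on the image, because [isomorphic]
    also requires non-edges to be preserved. *)
Definition image_edges (phi : {ffun vertex F -> T}) : {set {set T}} :=
  [set g in edges G | (g \subset image_set phi) &&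
    [exists x, exists y, adj_on F x y && (g == [set phi x; phi y])]].

Lemma image_edgesP phi g :
  g \in image_edges phi -> (#|g| == 2) && (g \subset image_set phi).
Proof. by rewrite inE => /and3P[/edgesP /andP[-> _] ->]. Qed.

Definition image_graph phi : graph T :=
  KGraph (image_set phi) (image_edges phi) (@image_edgesP phi).

Lemma copy_image_graph (phi : {ffun vertex F -> T}) :
  injective phi -> image_set phi \subset verts G ->
  (forall x y, adj_on F x y -> adj G (phi x) (phi y)) ->
  copy F G (image_graph phi).
Proof.
move=> phi_inj phiG phi_hom; split.
  by split=> //; apply/subsetP => g /setIdP[].
have phi_in x : phi x \in verts (image_graph phi) by apply: imset_f.
exists (fun x => exist _ (phi x) (phi_in x)); split.
  apply: inj_card_bij; first by move=> x y [] /phi_inj.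
  by rewrite card_vertex /= card_imset.
move=> x y /=; apply/idP/idP => [|xy].
  rewrite /adj inE => /and3P[_ _ /existsP[x' /existsP[y' /andP[xy' /eqP eq_g]]]].
  have xg : phi x \in [set phi x'; phi y'] by rewrite -eq_g set21.
  have yg : phi y \in [set phi x'; phi y'] by rewrite -eq_g set22.
  have x'g : phi x' \in [set phi x; phi y] by rewrite eq_g set21.
  have y'g : phi y' \in [set phi x; phi y] by rewrite eq_g set22.
  move: xg yg x'g y'g; rewrite !inE !(inj_eq phi_inj).
  have neq' : x' != y' by apply: contraTneq xy' => ->; rewrite /adj_on adj_irr.
  case/orP=> /eqP ->; case/orP=> /eqP -> //.
  - by rewrite eqxx !orbb eq_sym (negPf neq').
  - by rewrite -/(adj F _ _) adjC.
  - by rewrite eqxx !orbb (negPf neq').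
rewrite /adj inE -/(adj G _ _) phi_hom //= subUset !sub1set !imset_f //=.
by apply/existsP; exists x; apply/existsP; exists y; rewrite eqxx andbT.
Qed.

Lemma tiling_of_embeddings (L : seq {ffun vertex F -> T}) :
  disjoint_embeddings (adj G) (adj_on F) (verts G) L ->
  exists (m : nat) (H : 'I_m -> graph T), tiling F G H /\
    #|\bigcup_(i < m) verts (H i)| = (#|verts F| * size L)%N.
Proof.
case=> L_emb L_disj L_card.
exists (size L), (fun i => image_graph (tnth (in_tuple L) i)).
split; last by rewrite -card_vertex -L_card /used big_tnth.
split=> [i|i j].
  by have [] := L_emb _ (mem_tnth i (in_tuple L)); apply: copy_image_graph.
have lt_disj (i' j' : 'I_(size L)) : (i' < j')%N ->
    [disjoint image_set (tnth (in_tuple L) i') & image_set (tnth (in_tuple L) j')].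
  have phi0 := tnth (in_tuple L) i'; rewrite !(tnth_nth phi0) => lt_ij.
  by have /(pairwiseP phi0) := L_disj; apply; rewrite ?inE.
rewrite neq_ltn => /orP[/lt_disj //|/lt_disj]; by rewrite disjoint_sym.
Qed.
End ImageGraph.

(** * Cleaning *)

Section Cleaning.
Variables (R : realType) (T I : finType) (G : graph T) (c : T -> I).
Variables (eps delta sigma : R) (M : nat).
Hypotheses (sigma_gt0 : 0 < sigma) (M_gt0 : (0 < M)%N) (card_I : (#|I| <= M)%N).
Hypothesis verts_gt0 : (0 < #|verts G|)%N.
Hypothesis small_defect :
  defect_count (adj G) (verts G) c eps delta <= sigma ^+ 2 * #|verts G|%:R ^+ 2.

Local Notation V := (color_class (verts G) c).
Local Notation dense x y := (lower_dense (adj G) eps delta (V (c x)) (V (c y))).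
Local Notation n := (#|verts G|%:R : R).

Definition defect_nbrs (x : T) : {set T} :=
  [set y in verts G | adj G x y && ~~ dense x y].

Definition defective : {set T} :=
  [set x in verts G | sigma * n < #|defect_nbrs x|%:R].

Definition in_small_class : {set T} :=
  [set x in verts G | #|V (c x)|%:R < sigma / M%:R * n].

Let n_gt0 : 0 < n. Proof. by rewrite ltr0n. Qed.

(** Markov's inequality: each defective vertex contributes more than [sigma * n] to a defect of at
    most [(sigma * n) ^+ 2]. *)
Lemma card_defective : #|defective|%:R <= sigma * n.
Proof.
have: #|defective|%:R * (sigma * n) <= sigma * n * (sigma * n).
  apply: le_trans (_ : sigma ^+ 2 * n ^+ 2 <= _); last by rewrite -exprMn expr2.
  apply: le_trans small_defect; rewrite /defect_count.
  rewrite (big_setID defective) /= (setIidPr _); last first.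
    by apply/subsetP => x /setIdP[].
  apply: ler_wpDr; first by apply: sumr_ge0 => x _; apply: sumr_ge0.
  rewrite mulr_natl -sumr_const; apply: ler_sum => x /setIdP[_ /ltW].
  move/le_trans; apply; rewrite -natr_sum ler_nat -sum1dep_card big_mkcondr.
  by apply: leq_sum => y _; case: (_ && _).
by rewrite ler_pM2r // mulr_gt0.
Qed.

(** There are at most [M] classes, and each small one has fewer than [sigma / M%:R * n] vertices. *)
Lemma card_in_small_class : #|in_small_class|%:R <= sigma * n.
Proof.
have -> : #|in_small_class|%:R =
    \sum_i #|[set x in in_small_class | c x == i]|%:R :> R.
  rewrite -natr_sum -sum1_card (partition_big c predT) //=.
  by congr (_%:R); apply: eq_bigr => i _; rewrite -sum1dep_card.
apply: le_trans (_ : \sum_(i : I) sigma / M%:R * n <= _).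
  apply: ler_sum => i _.
  have [->|[x /setIdP[/setIdP[_ small] /eqP cx]]] :=
      set_0Vmem [set x in in_small_class | c x == i].
    by rewrite cards0 mulr_ge0 // divr_ge0 // ltW.
  apply: le_trans (ltW small).
  rewrite cx ler_nat; apply/subset_leq_card/subsetP => y.
  by rewrite !inE => /andP[/andP[-> _] ->].
rewrite sumr_const -[_ *+ #|_|]mulr_natl mulrA ler_wpM2r //.
rewrite mulrA ler_pdivrMr ?ltr0n // mulrC ler_wpM2l ?ler_nat //.
exact: ltW.
Qed.

Definition clean_edges : {set {set T}} :=
  [set f in edges G | (f \subset verts G :\: (defective :|: in_small_class)) &&
    [forall x in f, forall y in f, (x != y) ==> dense x y]].

Lemma clean_edgesP f : f \in clean_edges ->
  (#|f| == 2) && (f \subset verts G :\: (defective :|: in_small_class)).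
Proof. by rewrite inE => /and3P[/edgesP /andP[-> _] ->]. Qed.

(** Density and class size still refer to the colour classes of [G], so deleting vertices here does
    not disturb them. The copies will be embedded in [G] itself. *)
Definition clean_graph : graph T :=
  KGraph (verts G :\: (defective :|: in_small_class)) clean_edges clean_edgesP.

Lemma clean_adj_dense x y : adj clean_graph x y -> dense x y.
Proof.
move=> xy; have neq : x != y by apply: contraTneq xy => ->; rewrite adj_irr.
move: xy; rewrite /adj inE => /and3P[_ _] /forall_inP/(_ x (set21 _ _)).
by move=> /forall_inP/(_ y (set22 _ _)); rewrite neq.
Qed.

Lemma clean_class_large x : x \in verts clean_graph ->
  sigma / M%:R * n <= #|V (c x)|%:R.
Proof.
by rewrite !inE => /andP[/norP[_ large] xG]; rewrite leNgt; move: large; rewrite xG.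
Qed.

(** A surviving vertex is not defective, so it loses at most [sigma * n] neighbours through blocks
    that are not dense, and at most [2 * sigma * n] that were deleted. *)
Lemma clean_approximation (mu : R) : 3 * sigma <= mu ->
  approximation mu mu clean_graph G.
Proof.
move=> mu_ge; have lost : #|defective :|: in_small_class|%:R <= 2 * sigma * n.
  apply: le_trans (_ : (#|defective| + #|in_small_class|)%:R <= _).
    by rewrite ler_nat leq_card_setU.
  have := card_defective; have := card_in_small_class; rewrite natrD; lra.
have mu_n : 3 * sigma * n <= mu * n by rewrite ler_wpM2r.
split.
- by split; [apply: subsetDl|apply/subsetP => f /setIdP[]].
- move=> v vG; have : (deg G v <= deg clean_graph v +
      (#|defect_nbrs v| + #|defective :|: in_small_class|))%N.
    apply: leq_trans (leq_add (leqnn _) (leq_card_setU _ _)).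
    apply: leq_trans (leq_card_setU _ _); apply/subset_leq_card/subsetP => u.
    rewrite inE => vu; rewrite in_setU inE.
    have /andP[vV uV] := adj_verts vu.
    have [u_in|u_in] := boolP (u \in defective :|: in_small_class).
      by rewrite in_setU u_in !orbT.
    have [vu_dense|vu_nd] := boolP (dense v u); last first.
      by rewrite in_setU [u \in defect_nbrs v]inE uV vu vu_nd orbT.
    apply/orP; left; rewrite /adj inE -/(adj G v u) vu /=.
    rewrite subUset !sub1set vG in_setD u_in uV /=.
    have uv_dense := lower_denseC (@adjC T G) vu_dense.
    apply/forall_inP => x xvu; apply/forall_inP => y yvu; apply/implyP.
    by case/set2P: xvu => ->; case/set2P: yvu => -> //; rewrite eqxx.
  rewrite -(ler_nat R) !natrD.
  have : #|defect_nbrs v|%:R <= sigma * n.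
    move: (vG); rewrite !inE => /andP[/norP[v_ok _] v_in].
    by rewrite leNgt; move: v_ok; rewrite v_in.
  lra.
- rewrite cardsD natrB; last by rewrite subset_leq_card ?subsetIl.
  have : #|verts G :&: (defective :|: in_small_class)|%:R <=
      #|defective :|: in_small_class|%:R :> R.
    by rewrite ler_nat subset_leq_card ?subsetIr.
  have : 0 <= sigma * n by rewrite mulr_ge0 // ltW.
  lra.
Qed.

Lemma card_clean_verts : (1 - 2 * sigma) * n <= #|verts clean_graph|%:R.
Proof.
rewrite cardsD natrB; last by rewrite subset_leq_card ?subsetIl.
have : #|verts G :&: (defective :|: in_small_class)|%:R <=
    (#|defective| + #|in_small_class|)%:R :> R.
  rewrite ler_nat (leq_trans _ (leq_card_setU _ _)) //.
  by rewrite subset_leq_card ?subsetIr.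
have := card_defective; have := card_in_small_class; rewrite natrD; lra.
Qed.

End Cleaning.

(** * Rounding *)

Section Rounding.
Variables (R : realType) (S T I : finType) (F : graph S) (G : graph T).
Variables (c : T -> I) (V : I -> {set T}).
Hypothesis V_class : forall v, v \in verts G -> v \in V (c v).

Definition hom_type (theta : {ffun vertex F -> vertex G}) : {ffun vertex F -> I} :=
  [ffun x => c (val (theta x))].

Definition type_weight (omega : {ffun vertex F -> vertex G} -> R)
    (tau : {ffun vertex F -> I}) : R :=
  \sum_(theta in Defs.Hom F G | hom_type theta == tau) omega theta.

(** Add up the capacity constraints of all vertices of colour [i], grouping homomorphisms by
    pattern. [V i] may be larger than the colour class within [G], which covers the case of a
    cleaned graph. *)
Lemma type_weight_class (omega : {ffun vertex F -> vertex G} -> R) i :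
  fractional_tiling omega ->
  \sum_tau type_weight omega tau * #|[set x | tau x == i]|%:R <= #|V i|%:R.
Proof.
move=> [omega01 cap].
apply: le_trans (_ : \sum_(v : vertex G | c (val v) == i)
    \sum_(theta in Defs.Hom F G) omega theta * #|[set x | theta x == v]|%:R <= _).
  rewrite exchange_big /= [leRHS](partition_big hom_type predT) //=.
  apply: ler_sum => tau _; rewrite mulr_suml; apply: ler_sum => theta.
  move=> /andP[_ /eqP <-]; rewrite -mulr_sumr -natr_sum le_eqVlt.
  apply/orP; left; apply/eqP; congr (_ * _%:R).
  rewrite -sum1dep_card (partition_big theta (fun v => c (val v) == i)) /=; last first.
    by move=> x; rewrite ffunE.
  apply: eq_bigr => v /eqP cv; rewrite -sum1dep_card; apply: eq_bigl => x.
  by rewrite ffunE; apply: andb_idl => /eqP ->; rewrite cv.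
apply: le_trans (_ : \sum_(v : vertex G | c (val v) == i) 1 <= _).
  by apply: ler_sum => v _; apply: cap.
rewrite sumr_const ler_nat -(card_imset _ val_inj).
apply/subset_leq_card/subsetP => t /imsetP[v].
rewrite unfold_in => /eqP <- ->.
exact/V_class/valP.
Qed.

(** Scaling by [1 - gamma] reserves free room in every class. Rounding down loses less than one copy
    per pattern, and the number of patterns does not depend on the size of [G]. *)
Lemma round_fractional_tiling (gamma : R)
    (omega : {ffun vertex F -> vertex G} -> R) :
  gamma <= 1 -> fractional_tiling omega ->
  exists s : seq {ffun vertex F -> I},
  [/\ forall tau, tau \in s -> exists2 theta, theta \in Defs.Hom F G & hom_type theta = tau,
      forall i, (\sum_(tau <- s) #|[set x | tau x == i]|)%:R
        <= (1 - gamma) * #|V i|%:R &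
      (1 - gamma) * \sum_(theta in Defs.Hom F G) omega theta
        <= (size s)%:R + (#|I| ^ #|vertex F|)%:R].
Proof.
move=> gamma_le1 tiling_omega; have [omega01 _] := tiling_omega.
pose w tau := (1 - gamma) * type_weight omega tau.
have w_ge0 tau : 0 <= w tau.
  rewrite mulr_ge0 ?subr_ge0 //; apply: sumr_ge0 => theta /andP[/omega01/andP[]//].
pose N tau := Num.truncn (w tau).
pose s := flatten [seq nseq (N tau) tau | tau <- enum {ffun vertex F -> I}].
have sumE (p : {ffun vertex F -> I} -> nat) :
    (\sum_(tau <- s) p tau = \sum_tau p tau * N tau)%N.
  rewrite /s big_flatten big_map big_enum; apply: eq_bigr => tau _.
  by rewrite big_nseq iter_addn_0.
exists s; split.
(* A pattern that is used has positive weight, so some homomorphism realises it. *)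
- move=> tau /flattenP[_ /mapP[tau' _ ->]]; rewrite mem_nseq => /andP[N_gt0 /eqP ->].
  have : 0 < w tau'.
    by move: N_gt0; rewrite /N truncn_gt0; apply: lt_le_trans.
  have [theta /andP[hom /eqP type]|none] :=
    pickP (fun theta => (theta \in Defs.Hom F G) && (hom_type theta == tau')).
    by exists theta.
  by rewrite /w /type_weight big_pred0 // mulr0 ltxx.
- move=> i; apply: le_trans (ler_wpM2l _ (type_weight_class i tiling_omega)); last first.
    by rewrite subr_ge0.
  rewrite sumE natr_sum mulr_sumr; apply: ler_sum => tau _.
  by rewrite natrM mulrC mulrA ler_wpM2r // truncn_le.
- have -> : size s = (\sum_tau N tau)%N.
    by rewrite -sum1_size sumE; apply: eq_bigr => tau _; rewrite mul1n.
  rewrite -card_ffun -sum1_card -natrD -big_split /= natr_sum.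
  rewrite (partition_big hom_type predT) //= mulr_sumr; apply: ler_sum => tau _.
  by rewrite addn1 ltW // truncnS_gt.
Qed.
End Rounding.

(** * Choice of constants and assembly *)

Lemma almost_tiling (R : realType) (S : finType) (F : graph S) (mu rho' : R) :
  0 < mu -> 0 < rho' ->
  exists rho0 : R, 0 < rho0 /\
  forall rho : R, rho <= rho0 ->
  exists n0 : nat, forall (T : finType) (G : graph T), (n0 <= #|verts G|)%N ->
  (forall G' : graph T, approximation mu mu G' G ->
     exists omega : {ffun vertex F -> vertex G'} -> R,
       fractional_tiling omega /\ almost_perfect rho omega) ->
  exists (m : nat) (H : 'I_m -> graph T), tiling F G H /\
    (1 - rho') * #|verts G|%:R <= #|\bigcup_(i < m) verts (H i)|%:R :> R.
Proof.
move=> mu_gt0 rho'_gt0.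
(* Cleaning needs [3 * sigma <= mu], and the final count loses a proportion of at most [5 * sigma];
   the factor 8 covers both. *)
pose sigma := Num.min (Num.min mu rho') 1 / 8%:R.
have [sigma_gt0 sigma_mu sigma_rho' sigma_1] :
    [/\ 0 < sigma, 8 * sigma <= mu, 8 * sigma <= rho' & 8 * sigma <= 1].
  have -> : 8 * sigma = Num.min (Num.min mu rho') 1 by rewrite /sigma; field.
  split; rewrite ?ge_min ?lexx ?orbT //.
  by rewrite divr_gt0 // !lt_min mu_gt0 rho'_gt0 ltr01.
exists sigma; split=> // rho rho_le.
(* With this [delta] the defect bound [4 * delta] of [regularity] is exactly the [sigma ^+ 2]
   assumed in cleaning. *)
pose h := #|verts F|; pose delta := sigma ^+ 2 / 4.
have delta_gt0 : 0 < delta by rewrite divr_gt0 ?exprn_gt0.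
have delta_le1 : delta <= 1 by rewrite /delta; nra.
(* Chosen so that the condition of [embed_avoiding] holds with equality for [gamma = sigma]. *)
pose eps := sigma * (delta / 2) ^+ h / h.+1%:R.
have eps_gt0 : 0 < eps by rewrite divr_gt0 // mulr_gt0 // exprn_gt0 // divr_gt0.
have eps_sigma : (2 / delta) ^+ h * (h.+1%:R * eps) = sigma.
  rewrite /eps [h.+1%:R * _]mulrC divfK ?pnatr_eq0 // mulrCA -exprMn.
  rewrite [2 / delta * _](_ : _ = 1) ?expr1n ?mulr1 //.
  by field; rewrite gt_eqF.
have eps_le1 : eps <= 1.
  apply: le_trans (_ : sigma <= _); last lra.
  rewrite -[leRHS]eps_sigma mulrA ler_peMl ?(ltW eps_gt0) //.
  apply: mulr_ege1; last by rewrite ler1n.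
  by apply: exprn_ege1; rewrite ler_pdivlMr // mul1r (le_trans delta_le1) // ler1n.
have [M [M_gt0 reg]] := regularity eps_gt0 eps_le1 delta_gt0.
(* Beyond [a], surviving classes satisfy [P_large]; beyond [b], the rounding loss of at most
   [h * M ^ h] vertices is below [sigma * n]. *)
pose a := 2 / delta / (eps * (sigma / M%:R)); pose b := (h * M ^ h)%:R / sigma.
exists (Num.truncn a + Num.truncn b).+2 => T G n_large robust.
set n := #|verts G| in n_large *.
have n_gt0 : (0 < n)%N by apply: leq_trans n_large.
have sM_gt0 : 0 < sigma / M%:R by rewrite divr_gt0 // ltr0n.
have n_a : 2 / delta <= eps * (sigma / M%:R * n%:R).
  have esM_gt0 : 0 < eps * (sigma / M%:R) by rewrite mulr_gt0.
  rewrite [leRHS]mulrA [leRHS]mulrC -ler_pdivrMr //; apply: ltW.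
  apply: lt_le_trans (truncnS_gt a) _; rewrite ler_nat.
  by apply: leq_trans n_large; rewrite -addSn leqW // leq_addr.
have n_b : (h * M ^ h)%:R <= sigma * n%:R.
  rewrite [leRHS]mulrC -ler_pdivrMr //; apply: ltW.
  apply: lt_le_trans (truncnS_gt b) _; rewrite ler_nat.
  by apply: leq_trans n_large; rewrite -addnS leqW // leq_addl.
have [I [c [cI]]] := reg T (adj G) (verts G).
rewrite (_ : 4 * delta = sigma ^+ 2) => [defect|]; last by rewrite /delta; field.
have [|omega [tiling_omega perfect]] := robust (clean_graph G c eps delta sigma M).
  by apply: clean_approximation => //; lra.
set G' := clean_graph _ _ _ _ _ _ in omega tiling_omega perfect.
have in_class v : v \in verts G' -> v \in color_class (verts G) c (c v).
  by move=> /setDP[vG _]; rewrite inE vG eqxx.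
have sigma_le1 : sigma <= 1 by lra.
have [s [s_hom s_cap s_size]] :=
  round_fractional_tiling in_class sigma_le1 tiling_omega.
have [tau tau_s Z Z_small|L [L_emb L_size _]] :=
    greedy_embeddings (e := adj G) (f := adj_on F) _ s_cap.
  (* The homomorphism behind [tau] lands in the cleaned graph. Hence the classes named by [tau] are
     large, and those joined by an edge of [F] form lower-dense pairs. *)
  have [theta /[!inE] /forallP hom tauE] := s_hom tau tau_s.
  have tau_x x : tau x = c (val (theta x)) by rewrite -tauE ffunE.
  apply: (embed_avoiding eps_gt0 delta_gt0 delta_le1 (@adjC _ _)) Z_small.
  - by move=> x y; rewrite /adj_on adjC.
  - move=> x y xy; rewrite !tau_x; apply: clean_adj_dense.
    by have /forallP/(_ y)/implyP := hom x; apply.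
  - move=> x; apply: le_trans n_a _; rewrite ler_pM2l // tau_x.
    exact/clean_class_large/valP.
  - by move=> x; rewrite /adj_on adj_irr.
  - by rewrite card_vertex eps_sigma.
have [m [H [tilingH cardH]]] := tiling_of_embeddings L_emb.
exists m, H; split=> //; rewrite cardH L_size natrM -/h.
have h_ge0 : 0 <= h%:R :> R by [].
have := ler_wpM2l h_ge0 s_size; rewrite mulrDr card_vertex -natrM.
have : (h * #|I| ^ h)%:R <= (h * M ^ h)%:R :> R.
  rewrite ler_nat leq_mul //; have [->|h_gt0] := posnP h; first by rewrite !expn0.
  by rewrite leq_exp2r.
move: perfect; rewrite /almost_perfect /weight -/h.
have := card_clean_verts sigma_gt0 M_gt0 cI n_gt0 defect; rewrite -/n -/G'.
set w := \sum_(theta in _) _; set n' := #|verts G'|%:R : R => n'_ge perf bound le_s.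
(* Scaling and the deficit [rho] each cost a factor of at least [1 - sigma], and cleaning a factor
   [1 - 2 * sigma], in total at least [1 - 4 * sigma]. Rounding takes a further [sigma * n]. *)
have rho_n' : (1 - sigma) * n' <= (1 - rho) * n' by rewrite ler_wpM2r // lerD2l lerN2.
have s1 : 0 <= 1 - sigma by lra.
have h1 := ler_wpM2l s1 (le_trans rho_n' perf).
have h2 := ler_wpM2l (mulr_ge0 s1 s1) n'_ge.
have nR_ge0 : 0 <= n%:R :> R by [].
have h3 : (1 - 4 * sigma) * n%:R <= (1 - sigma) * (1 - sigma) * ((1 - 2 * sigma) * n%:R).
  rewrite [leRHS]mulrA ler_wpM2r //; nra.
have h4 : (1 - rho') * n%:R <= (1 - 5 * sigma) * n%:R.
  by rewrite ler_wpM2r //; lra.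
move: h1 h2 le_s bound n_b; rewrite -/h; lra.
Qed.

Theorem theorem9p1 (R : realType) (k a b : nat)
  (hk : (0 < k)%N) (ha : (0 < a)%N) (hb : (0 < b)%N)
  (hab : (a <= b)%N) (hcop : coprime a b)
  (mu : R) (hmu : 0 < mu <= 1) :
  exists rho'0 : R, 0 < rho'0 /\
  forall rho' : R, 0 < rho' <= rho'0 ->
  exists rho0 : R, 0 < rho0 /\
  forall rho : R, 0 < rho <= rho0 ->
  exists n0 : nat,
  forall n : nat, (n0 <= n)%N ->
  forall (l t : nat) (T : finType) (G : graph T),
    #|verts G| = n ->
    robust_tiling_framework mu k a b rho t l G ->
    exists (m : nat) (H : 'I_m -> graph T),
      tiling (Bchi k a b) G H /\
      (1 - rho') * n%:R <= #|\bigcup_(i < m) verts (H i)|%:R :> R.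
Proof.
have /andP[mu_gt0 _] := hmu.
(* [almost_tiling] handles every positive [rho'], so 1 is just a convenient value. *)
exists 1; split=> // rho' /andP[rho'_gt0 _].
have [rho0 [rho0_gt0 main]] := almost_tiling (Bchi k a b) mu_gt0 rho'_gt0.
exists rho0; split=> // rho /andP[_ /main[n0 {}main]].
exists n0 => n n_large l t T G nE robust; subst n.
by apply: main => // G' /robust[].
Qed.
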